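(* Let $(V,V^+,\Vert\cdot\Vert)$ be a complete order smooth $1$-normed space satisfying $(OS.1.2)$ and let $W$ be a closed subspace of $V$. If $W$ is an $L$-summand in $V$, then $W$ is a smooth $1$-order ideal in $V$.
   Context: A cone in a real vector space is a set $C$ with $\lambda x+y\in C$ for $x,y\in C$, $\lambda\ge 0$; it is proper if $C\cap(-C)=\{0\}$. For a cone $V^+$ in $V$, write $x\le y$ if $y-x\in V^+$; $V^+$ is generating if $V=V^+-V^+$. A real normed space $V$ with a cone $V^+$ is an order smooth $1$-normed space if $V^+$ is proper, generating and norm closed, and: $(O.1.1)$: $u\le v\le w$ implies $\Vert v\Vert\le\Vert u\Vert+\Vert w\Vert$; $(O.1.2)$: for every $v\in V$ and $\epsilon>0$ there are $v_1,v_2\in V^+$ with $v=v_1-v_2$ and $\Vert v_1\Vert+\Vert v_2\Vert<\Vert v\Vert+\epsilon$. It satisfies $(OS.1.2)$ if for every $v\in V$ there are $v_1,v_2\in V^+$ with $v=v_1-v_2$ and $\Vert v_1\Vert+\Vert v_2\Vert\le\Vert v\Vert$. For a closed subspace $W$ of $V$: $W^+=W\cap V^+$; $V^{*+}=\{f\in V^*: f(v)\ge0\ \forall v\in V^+\}$; $W^\perp=\{f\in V^*:f|_W=0\}$; $\varphi_W:V\to V/W$ and $\varphi_{W^\perp}:V^*\to V^*/W^\perp$ are the quotient maps; quotients carry the quotient norm; $(V/W)^+=\overline{\varphi_W(V^+)}^{\Vert\cdot\Vert}$ (norm closure). The weak$^*$ topology on $V^*/W^\perp$ is the one coming from its identification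 with $W^*$. $W$ is a smooth $1$-order ideal in $V$ if: (i) $\varphi_{W^\perp}(V^{*+})=\overline{\varphi_{W^\perp}(V^{*+})}^{w^*}$; (ii) $(W,W^+,\Vert\cdot\Vert)$ is an order smooth $1$-normed space; (iii) $(V/W,(V/W)^+,\Vert\cdot\Vert)$ is an order smooth $1$-normed space. A closed subspace $W$ of a Banach space $V$ is an $L$-summand if there is a subspace $W'$ of $V$ with $V=W\oplus_1 W'$, i.e. $V$ is the algebraic direct sum of $W$ and $W'$ and $\Vert w+w'\Vert=\Vert w\Vert+\Vert w'\Vert$ for all $w\in W$, $w'\in W'$. *)

(* Defs.v *)
From HB Require Import structures.
From mathcomp Require Import all_boot all_order all_algebra.
From mathcomp Require Import generic_quotient ring_quotient.
From mathcomp Require Import all_classical all_reals all_analysis.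

Set Implicit Arguments.
Unset Strict Implicit.
Unset Printing Implicit Defensive.

Import Order.TTheory GRing.Theory Num.Theory.
Import numFieldNormedType.Exports.

Local Open Scope classical_set_scope.
Local Open Scope ring_scope.
Local Open Scope quotient_scope.

Section OrderSmooth.
Context {R : realType} {E : normedModType R}.
Implicit Types C : set E.

(* The empty set satisfies [cone]; [proper_cone] excludes it. *)
Definition cone C := forall (l : R) (x y : E), 0 <= l -> C x -> C y -> C (l *: x + y).

Definition proper_cone C := C `&` [set - x | x in C] = [set 0].

Definition generating C := [set x - y | x in C & y in C] = setT.

Definition cone_le C (x y : E) := C (y - x).

Definition O_1_1 C := forall u v w : E,
  cone_le C u v -> cone_le C v w -> `|v| <= `|u| + `|w|.

Definition O_1_2 C := forall (v : E) (e : R), 0 < e ->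
  exists v1 v2, [/\ C v1, C v2, v = v1 - v2 & `|v1| + `|v2| < `|v| + e].

Definition OS_1_2 C := forall v : E,
  exists v1 v2, [/\ C v1, C v2, v = v1 - v2 & `|v1| + `|v2| <= `|v|].

Record order_smooth_1_normed C : Prop := OrderSmooth1Normed {
  osn_cone : cone C;
  osn_proper : proper_cone C;
  osn_generating : generating C;
  osn_closed : closed C;
  osn_O_1_1 : O_1_1 C;
  osn_O_1_2 : O_1_2 C }.

End OrderSmooth.

HB.mixin Record isTopClosed (R : realType) (E : normedModType R) (S : {pred E}) := {
  pred_closed : closed [set` S] }.

#[short(type="closedSubspace")]
HB.structure Definition ClosedSubspace (R : realType) (E : normedModType R) :=
  {S of GRing.SubmodClosed R S & isTopClosed R E S}.

Definition subspace_of (R : realType) (E : lmodType R) (W : submodClosed E) :=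
  {x : E | x \in W}.

Section SubspaceOf.
Context {R : realType} {E : lmodType R} (W : submodClosed E).
HB.instance Definition _ := SubChoice.on (subspace_of W).
HB.instance Definition _ := [SubChoice_isSubLmodule of subspace_of W by <:].
End SubspaceOf.

Section SubspaceNorm.
Context {R : realType} {E : normedModType R} (W : submodClosed E).

Definition subspace_norm (x : subspace_of W) : R := `|val x|.

Lemma subspace_normD x y :
  subspace_norm (x + y) <= subspace_norm x + subspace_norm y.
Proof. by rewrite /subspace_norm raddfD ler_normD. Qed.

Lemma subspace_normZ (l : R) x : subspace_norm (l *: x) = `|l| * subspace_norm x.
Proof. by rewrite /subspace_norm linearZ normrZ. Qed.

Lemma subspace_norm0_eq0 x : subspace_norm x = 0 -> x = 0.
Proof.
by move=> /eqP; rewrite normr_eq0 => /eqP x0; apply: val_inj; rewrite raddf0.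
Qed.

HB.instance Definition _ := Lmodule_isNormed.Build R (subspace_of W)
  subspace_normD subspace_normZ subspace_norm0_eq0.
End SubspaceNorm.

Lemma subspace_val_continuous (R : realType) (E : normedModType R)
    (W : submodClosed E) : continuous (val : subspace_of W -> E).
Proof.
move=> x; apply/(@cvgrPdist_lt _ _ _ (nbhs x)) => e e0.
by apply/nbhs_ballP; exists e => // y /=.
Qed.

Section QuotientOf.
Context {R : realType} {E : lmodType R} (W : submodClosed E).

(* [submodClosed] does not carry closure under opposite, needed by
   [Quotient.quot]. *)
Definition subspace_zmod : zmodClosed E := HB.pack (W : {pred E})
  (GRing.isZmodClosed.Build E (W : {pred E}) (GRing.submod_closedB (submodClosedP W))).

Definition quotient_of := Quotient.quot subspace_zmod.

HB.instance Definition _ := GRing.Zmodule.on quotient_of.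
HB.instance Definition _ := Quotient.on quotient_of.

Definition quotient_map : E -> quotient_of := \pi_quotient_of.

Lemma quotient_map_surj q : quotient_map (repr q) = q.
Proof. exact: reprK. Qed.

Lemma quotient_mapB : {morph quotient_map : x y / x - y}.
Proof. by move=> x y; exact: (raddfB \pi_(Quotient.quot subspace_zmod)). Qed.

Lemma quotient_map_eq x y : quotient_map x = quotient_map y <-> x - y \in W.
Proof.
rewrite (_ : (_ \in W) = (x - y \in subspace_zmod))//.
by rewrite Quotient.idealrBE; split => /eqP.
Qed.

Definition quotient_scale (l : R) (q : quotient_of) : quotient_of :=
  quotient_map (l *: repr q).

Lemma quotient_mapZ l x : quotient_map (l *: x) = quotient_scale l (quotient_map x).
Proof.
apply/quotient_map_eq; rewrite -scalerBr rpredZ//.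
by apply/quotient_map_eq; rewrite quotient_map_surj.
Qed.

Lemma quotient_mapD : {morph quotient_map : x y / x + y}.
Proof. by move=> x y; exact: (raddfD \pi_(Quotient.quot subspace_zmod)). Qed.

Lemma quotient_scaleA a b q :
  quotient_scale a (quotient_scale b q) = quotient_scale (a * b) q.
Proof. by rewrite -[q]quotient_map_surj -!quotient_mapZ scalerA. Qed.

Lemma quotient_scale1 : left_id 1 quotient_scale.
Proof. by move=> q; rewrite -[q]quotient_map_surj -!quotient_mapZ scale1r. Qed.

Lemma quotient_scaleDr : right_distributive quotient_scale +%R.
Proof.
move=> a p q; rewrite -[p]quotient_map_surj -[q]quotient_map_surj.
by rewrite -quotient_mapD -!quotient_mapZ scalerDr quotient_mapD.
Qed.

Lemma quotient_scaleDl q : {morph quotient_scale^~ q : a b / a + b}.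
Proof.
move=> a b; rewrite -[q]quotient_map_surj -!quotient_mapZ scalerDl.
by rewrite quotient_mapD.
Qed.

HB.instance Definition _ := GRing.Zmodule_isLmodule.Build R quotient_of
  quotient_scaleA quotient_scale1 quotient_scaleDr quotient_scaleDl.

Lemma quotient_map_linear : linear quotient_map.
Proof. by move=> a x y; rewrite quotient_mapD quotient_mapZ. Qed.

HB.instance Definition _ :=
  GRing.isLinear.Build R E quotient_of *:%R quotient_map quotient_map_linear.

End QuotientOf.

Section QuotientNorm.
Context {R : realType} {E : normedModType R}.

Definition quotient_norm (W : submodClosed E) (q : quotient_of W) : R :=
  inf [set `|x| | x in [set x | quotient_map W x = q]].

Section SubmodNorm.
Variable W : submodClosed E.
Implicit Type q : quotient_of W.

Let reps q := [set `|x| | x in [set x | quotient_map W x = q]].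

Let reps_has_inf q : has_inf (reps q).
Proof.
split; first by exists `|repr q|, (repr q) => //; exact: quotient_map_surj.
by exists 0 => _ [x _ <-].
Qed.

Lemma quotient_norm_le x : quotient_norm (quotient_map W x) <= `|x|.
Proof. by apply: ge_inf; [case: (reps_has_inf (quotient_map W x)) | exists x]. Qed.

Lemma quotient_norm_lt q e : 0 < e ->
  exists2 x, quotient_map W x = q & `|x| < quotient_norm q + e.
Proof.
move=> e0; have [_ [x xq <-] ?] := inf_adherent e0 (reps_has_inf q).
by exists x.
Qed.

Lemma quotient_norm_ge0 q : 0 <= quotient_norm q.
Proof. by apply: lb_le_inf; [case: (reps_has_inf q) | move=> _ [x _ <-]]. Qed.

Lemma quotient_normD p q : quotient_norm (p + q) <= quotient_norm p + quotient_norm q.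
Proof.
apply/ler_addgt0Pr => e e0; have e20 : 0 < e / 2 by rewrite divr_gt0.
have [x <- xe] := quotient_norm_lt p e20; have [y <- ye] := quotient_norm_lt q e20.
rewrite -raddfD (le_trans (quotient_norm_le _))// (le_trans (ler_normD _ _))//.
by rewrite [e]splitr addrACA ltW// ltrD.
Qed.

Let quotient_normZ_le (l : R) q : quotient_norm (l *: q) <= `|l| * quotient_norm q.
Proof.
have [->|l0] := eqVneq l 0.
  rewrite scale0r normr0 mul0r -(raddf0 (quotient_map W)).
  by rewrite (le_trans (quotient_norm_le _))// normr0.
rewrite -ler_pdivrMl ?normr_gt0//; apply: lb_le_inf; first by case: (reps_has_inf q).
move=> _ [x <- <-]; rewrite ler_pdivrMl ?normr_gt0// -normrZ -linearZ.
exact: quotient_norm_le.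
Qed.

Lemma quotient_normZ (l : R) q : quotient_norm (l *: q) = `|l| * quotient_norm q.
Proof.
have [->|l0] := eqVneq l 0.
  apply/eqP; rewrite eq_le quotient_normZ_le/= normr0 mul0r.
  exact: quotient_norm_ge0.
apply/eqP; rewrite eq_le quotient_normZ_le/= -ler_pdivlMl ?normr_gt0//.
rewrite -normfV -[in leLHS](scalerK l0 q); exact: quotient_normZ_le.
Qed.
End SubmodNorm.

Section ClosedNorm.
Variable W : closedSubspace E.

Lemma quotient_norm0_eq0 (q : quotient_of W) : quotient_norm q = 0 -> q = 0.
Proof.
move=> q0; rewrite -[q]quotient_map_surj -(raddf0 (quotient_map W)).
apply/quotient_map_eq; rewrite subr0.
have /closure_id WE := @pred_closed _ _ W.
suff : [set` W] (repr q) by [].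
rewrite WE => B /nbhs_normP[e /= e0 eB].
have [x xq] := quotient_norm_lt q e0; rewrite q0 add0r => xe.
exists (repr q - x); split.
  by apply/quotient_map_eq; rewrite quotient_map_surj.
by apply: eB => /=; rewrite opprB addrC subrK.
Qed.

HB.instance Definition _ := Lmodule_isNormed.Build R (quotient_of W)
  (@quotient_normD W) (@quotient_normZ W) quotient_norm0_eq0.
End ClosedNorm.
End QuotientNorm.

Definition dual_pred (R : realType) (E : normedModType R) : {pred E -> R^o} :=
  [pred f : E -> R^o | `[< linear f /\ continuous f >]].

Arguments dual_pred {R} E _.

Section Dual.
Context {R : realType}.

Lemma dual_pred_submod (E : normedModType R) : submod_closed (dual_pred E).
Proof.
split=> [|a f g].
  apply/asboolP; split=> [b x y|]; last exact: cst_continuous.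
  by rewrite /= scaler0 addr0.
move=> /asboolP[fl fc] /asboolP[gl gc]; apply/asboolP; split=> [b x y|x].
  have hE z : (a *: f + g) z = a *: f z + g z by [].
  by rewrite !hE fl gl !scalerDr !scalerA [a * b]mulrC addrACA.
by apply: cvgD; [apply: cvgZl_tmp; exact: fc|exact: gc].
Qed.

HB.instance Definition _ (E : normedModType R) :=
  GRing.isSubmodClosed.Build R (E -> R^o) (dual_pred E) (dual_pred_submod E).

Definition dual (E : normedModType R) := subspace_of (dual_pred E).

HB.instance Definition _ (E : normedModType R) := GRing.Lmodule.on (dual E).

Definition dual_fun (E : normedModType R) (f : dual E) : E -> R^o := val f.
Coercion dual_fun : dual >-> Funclass.

(* The initial topology of the evaluations at the points of [E]. *)
Definition weak_star (E : normedModType R) : Type := initial_topology (@dual_fun E : dual E -> {ptws E -> R^o}).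

HB.instance Definition _ (E : normedModType R) := Topological.copy (weak_star E)
   (initial_topology (@dual_fun E : dual E -> {ptws E -> R^o})).

Definition dual_cone (E : normedModType R) (C : set E) : set (dual E) :=
  [set f : dual E | forall v, C v -> 0 <= f v].

Section Annihilator.
Context {E : normedModType R} (W : submodClosed E).

Definition annihilator : {pred dual E} :=
  [pred f : dual E | `[< forall w, w \in W -> dual_fun f w = 0 >]].

Lemma annihilator_submod : submod_closed annihilator.
Proof.
split=> [|a f g /asboolP fW /asboolP gW]; apply/asboolP => w wW //.
by rewrite (_ : dual_fun _ w = a *: dual_fun f w + dual_fun g w)// fW// gW// scaler0 addr0.
Qed.

HB.instance Definition _ :=
  GRing.isSubmodClosed.Build R (dual E) annihilator annihilator_submod.

Lemma restrict_subproof (f : dual E) :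
  (fun w : subspace_of W => dual_fun f (val w)) \in dual_pred (subspace_of W).
Proof.
have /asboolP[fl fc] := valP f; apply/asboolP; split=> [a x y|x].
  exact: fl.
apply: (@continuous_comp _ _ _ (val : subspace_of W -> E) (dual_fun f)).
  exact: subspace_val_continuous.
exact: fc.
Qed.

Definition restrict (f : dual E) : dual (subspace_of W) :=
  exist (fun g => g \in dual_pred _) _ (restrict_subproof f).

(* f + annihilator W |-> f restricted to W: injective by
   [dual_quotient_ident_inj], and onto by the Hahn-Banach theorem, so that the
   initial topology it induces is the transport of the weak* topology of W^*. *)
Definition dual_quotient_ident (q : quotient_of annihilator) :
  dual (subspace_of W) := restrict (repr q).

Lemma dual_quotient_identE f :
  dual_quotient_ident (quotient_map annihilator f) = restrict f.
Proof.
apply/val_inj/funext => w /=.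
have : repr (quotient_map annihilator f) - f \in annihilator.
  by apply/(quotient_map_eq annihilator); exact: (quotient_map_surj (W := annihilator)).
move=> /asboolP H; apply/eqP; rewrite -subr_eq0; apply/eqP.
exact: (H _ (valP w)).
Qed.

Lemma dual_quotient_ident_inj : injective dual_quotient_ident.
Proof.
move=> p q; rewrite -[p]quotient_map_surj -[q]quotient_map_surj.
rewrite !dual_quotient_identE => /(congr1 val) /= pq.
apply/quotient_map_eq/asboolP => w wW; apply/eqP; rewrite subr_eq0; apply/eqP.
exact: (congr1 (@^~ (exist _ w wW)) pq).
Qed.

Definition weak_star_quotient : Type :=
  initial_topology (dual_quotient_ident : _ -> weak_star (subspace_of W)).

HB.instance Definition _ := Topological.copy weak_star_quotient
  (initial_topology (dual_quotient_ident : _ -> weak_star (subspace_of W))).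

End Annihilator.
End Dual.

Section Ideals.
Context {R : realType} {V : normedModType R}.
Implicit Types (Vp : set V) (W : closedSubspace V).

Definition subspace_cone Vp W : set (subspace_of W) := [set w | Vp (val w)].

Definition quotient_cone Vp W : set (quotient_of W) :=
  closure (quotient_map W @` Vp).

Definition positive_dual_image Vp W : set (weak_star_quotient W) :=
  quotient_map (annihilator W) @` dual_cone Vp.

End Ideals.
Arguments subspace_cone {R V} Vp W _.
Arguments quotient_cone {R V} Vp W _.
Arguments positive_dual_image {R V} Vp W _.

Record smooth_1_order_ideal (R : realType) (V : normedModType R) (Vp : set V)
    (W : closedSubspace V) : Prop := Smooth1OrderIdeal {
  s1oi_weak_star : positive_dual_image Vp W = closure (positive_dual_image Vp W);
  s1oi_subspace : order_smooth_1_normed (subspace_cone Vp W);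
  s1oi_quotient : order_smooth_1_normed (quotient_cone Vp W) }.

Definition L_summand (R : realType) (V : normedModType R) (W : closedSubspace V) :=
  exists W' : submodClosed V,
  [/\ [set w + w' | w in [set` W] & w' in [set` W']] = setT,
      [set` W] `&` [set` W'] = [set 0] &
      forall w w', w \in W -> w' \in W' -> `|w + w'| = `|w| + `|w'|].

(* Main.v *)
(** Let [P] be the projection of [V] onto [W] along its L-complement, so that
[|v| = |P v| + |v - P v|].  If [v >= 0], decompose [P v = a1 - a2] and
[v - P v = b1 - b2] by (OS.1.2).  Then [0 <= v <= a1 + b1], hence
[|a1| + |a2| + |b1| + |b2| <= |v| <= |a1| + |b1|] and [a2 = b2 = 0]: both [P] and
[1 - P] are positive.  So [P] carries decompositions of elements of [W] into
[W], [1 - P] induces a positive isometric section of the quotient map, which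
identifies the quotient with an isometric copy inside [V], and every positive
functional on [W] extends to the positive functional [f \o P], so that the image
of the positive dual cone is the weak*-closed cone of positive functionals. *)
Require Import Defs.
From HB Require Import structures.
From mathcomp Require Import all_boot all_order all_algebra.
From mathcomp Require Import all_classical all_reals all_analysis.

Set Implicit Arguments.
Unset Strict Implicit.
Unset Printing Implicit Defensive.

Import Order.TTheory GRing.Theory Num.Theory.
Import numFieldNormedType.Exports.

Local Open Scope classical_set_scope.
Local Open Scope ring_scope.

Lemma linear_contraction_continuous (R : realType) (E F : normedModType R)
    (s : {linear E -> F}) : (forall x, `|s x| <= `|x|) -> continuous s.
Proof.
move=> sle x; apply/cvgrPdist_lt => e e0.
apply/nbhs_ballP; exists e => // y; rewrite -ball_normE /= => xy.
by rewrite -raddfB (le_lt_trans (sle _)).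
Qed.

(** An isometry pulls back every axiom except the existence of decompositions, which is therefore
    assumed on the preimage; it yields both generation and (O.1.2). Applied to the inclusion of [W]
    and to the section of the quotient map. *)
Lemma order_smooth_preimage (R : realType) (E F : normedModType R)
    (s : {linear E -> F}) (C : set F) : (forall x, `|s x| = `|x|) ->
  order_smooth_1_normed C -> OS_1_2 (s @^-1` C) ->
  order_smooth_1_normed (s @^-1` C).
Proof.
move=> iso [Ccone Cproper _ Cclosed CO _] CD; split.
- by move=> l x y l0 Cx Cy; rewrite /preimage /= linearP; exact: Ccone.
- have C0 : C 0 by have : [set 0 : F] 0 by []; rewrite -Cproper => -[].
  rewrite /proper_cone predeqE => x; split => [[Cx [y Cy yx]]|->]; last first.
    by split; [|exists 0; rewrite ?oppr0//]; rewrite /preimage /= linear0.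
  have : (C `&` [set - z | z in C]) (s x).
    by split => //; exists (s y) => //; rewrite -yx linearN.
  rewrite Cproper => /= sx0; apply/eqP.
  by rewrite -normr_eq0 -iso sx0 normr0.
- rewrite /generating predeqE => x; split => // _.
  by have [v1 [v2 [C1 C2 -> _]]] := CD x; exists v1 => //; exists v2.
- apply: closed_comp => // x _; apply: linear_contraction_continuous.
  by move=> y; rewrite iso.
- move=> u v w; rewrite /cone_le /preimage /= !linearB => uv vw.
  by rewrite -!iso; exact: CO.
- move=> v e e0; have [v1 [v2 [C1 C2 vE vle]]] := CD v.
  by exists v1, v2; split => //; rewrite (le_lt_trans vle)// ltrDl.
Qed.

Lemma L_projection (R : realType) (V : normedModType R) (W : closedSubspace V) :
  L_summand W -> exists P : {linear V -> V},
    [/\ forall v, P v \in W, forall w, w \in W -> P w = w &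
        forall v, `|v| = `|P v| + `|v - P v| ].
Proof.
move=> [W' [sum cap norm]].
have /choice[p pP] v : exists w, w \in W /\ v - w \in W'.
  have : [set: V] v by []; rewrite -sum => -[w /= wW [w' /= w'W' <-]].
  by exists w; rewrite addrAC subrr add0r.
(* Two candidate components differ by an element of both summands, hence by 0. This uniqueness makes
   the chosen [p] linear. *)
have uniq v w : w \in W -> v - w \in W' -> p v = w.
  move=> wW w'W'; have [pW pW'] := pP v.
  apply/eqP; rewrite -subr_eq0; apply/eqP.
  suff : ([set` W] `&` [set` W']) (p v - w) by rewrite cap.
  split => /=; first by have [_ ->] := GRing.submod_closedB (submodClosedP W).
  have -> : p v - w = (v - w) - (v - p v) by rewrite opprB [RHS]addrC addrA subrK.
  by have [_ ->] := GRing.submod_closedB (submodClosedP W').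
have p_linear : linear p.
  move=> a x y; have [xW xW'] := pP x; have [yW yW'] := pP y.
  apply: uniq; first by rewrite rpredD// rpredZ.
  by rewrite opprD addrACA -scalerBr rpredD// rpredZ.
pose P : {linear V -> V} := HB.pack p (GRing.isLinear.Build R V V *:%R p p_linear).
exists P; split => [v|w wW|v].
- by have [] := pP v.
- by apply: uniq; rewrite // subrr rpred0.
- by have [vW vW'] := pP v; rewrite -norm// addrC subrK.
Qed.

Section Positive.
Context {R : realType} {V : normedModType R} (Vp : set V).
Hypotheses (hV : order_smooth_1_normed Vp) (hOS : OS_1_2 Vp).
Variable P : {linear V -> V}.
Hypothesis normP : forall v : V, `|v| = `|P v| + `|v - P v|.

Lemma L_projection_positive v : Vp v -> Vp (P v) /\ Vp (v - P v).
Proof.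
move=> v0; have [Ccone _ _ _ CO _] := hV.
have [a1 [a2 [Ca1 Ca2 aE ale]]] := hOS (P v).
have [b1 [b2 [Cb1 Cb2 bE ble]]] := hOS (v - P v).
have CD x y : Vp x -> Vp y -> Vp (x + y).
  by move=> ? ?; rewrite -[x]scale1r; exact: Ccone.
have vle : `|v| <= `|a1| + `|b1|.
  rewrite (le_trans _ (ler_normD _ _))//.
  have := CO 0 v (a1 + b1); rewrite normr0 add0r; apply.
    by rewrite /cone_le subr0.
  rewrite /cone_le (_ : a1 + b1 - v = a2 + b2); first exact: CD.
  rewrite -[v](subrK (P v)) bE aE [b1 - b2 + _]addrC addrACA opprD addrA.
  by rewrite subrr add0r opprD !opprK.
have le0 : `|a2| + `|b2| <= 0.
  rewrite -(lerD2l (`|a1| + `|b1|)) addr0 addrACA.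
  by rewrite (le_trans (lerD ale ble))// -normP.
have a20 : a2 = 0.
  apply/eqP; rewrite -normr_le0; apply: le_trans le0.
  by rewrite lerDl.
have b20 : b2 = 0.
  apply/eqP; rewrite -normr_le0; apply: le_trans le0.
  by rewrite lerDr.
by rewrite bE aE a20 b20 !subr0.
Qed.

Lemma L_projection_le v : `|P v| <= `|v|.
Proof. by rewrite [leRHS]normP lerDl. Qed.

Lemma L_projection_compl_le v : `|v - P v| <= `|v|.
Proof. by rewrite [leRHS]normP lerDr. Qed.

Variable W : closedSubspace V.
Hypotheses (PW : forall v, P v \in W) (PK : forall w, w \in W -> P w = w).

Lemma L_summand_subspace : order_smooth_1_normed (subspace_cone Vp W).
Proof.
have := @order_smooth_preimage R (subspace_of W) V (val : {linear subspace_of W -> V}) Vp.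
apply => // w.
have [v1 [v2 [C1 C2 vE vle]]] := hOS (val w).
(* The parts found in [V] may lie outside [W]; [P] moves them there, keeping positivity, not
   increasing norms and fixing [val w]. *)
pose r v : subspace_of W := exist _ (P v) (PW v).
exists (r v1), (r v2); split.
- by have [] := L_projection_positive C1.
- by have [] := L_projection_positive C2.
- apply/val_inj; rewrite [RHS]raddfB /= -(raddfB P) -vE; apply/esym/PK; exact: (valP w).
- by rewrite (le_trans _ vle)// lerD// L_projection_le.
Qed.

(** The choice of [repr] is immaterial, since [1 - P] vanishes on [W]. *)
Definition quotient_section (q : quotient_of W) : V := repr q - P (repr q).

Lemma quotient_section_map v : quotient_section (quotient_map W v) = v - P v.
Proof.
rewrite /quotient_section; set u := repr _.
have /PK : u - v \in W.
  by apply/(quotient_map_eq W); rewrite /u quotient_map_surj.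
rewrite raddfB => /eqP; rewrite subr_eq addrAC eq_sym subr_eq => /eqP uv.
apply/eqP; rewrite subr_eq addrAC eq_sym subr_eq.
by rewrite [v + _]addrC uv addrC.
Qed.

Lemma quotient_sectionK : cancel quotient_section (quotient_map W).
Proof.
move=> q; rewrite -[RHS]quotient_map_surj; apply/(quotient_map_eq W).
by rewrite /quotient_section addrAC subrr add0r -scaleN1r rpredZ// PW.
Qed.

Lemma quotient_section_linear : linear quotient_section.
Proof.
move=> a p q; rewrite -[p]quotient_map_surj -[q]quotient_map_surj.
rewrite -linearP !quotient_section_map linearP.
by rewrite opprD addrACA -scalerBr.
Qed.

HB.instance Definition _ := GRing.isLinear.Build R (quotient_of W) V *:%R
  quotient_section quotient_section_linear.

(** Every representative [x] of [q] has the section value [x - P x], of norm at most that of [x];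
    take the infimum. Conversely the quotient map is a contraction. *)
Lemma norm_quotient_section q : `|quotient_section q| = `|q|.
Proof.
apply/eqP; rewrite eq_le; apply/andP; split; last first.
  by rewrite -[in leLHS](quotient_sectionK q); exact: quotient_norm_le.
apply/ler_addgt0Pr => e e0.
have [x <- xe] := quotient_norm_lt q e0.
rewrite quotient_section_map (le_trans (L_projection_compl_le _))//.
exact: ltW.
Qed.

(** Positivity of [1 - P] identifies the image of [Vp] with this preimage, which is already closed
    because the section is continuous. *)
Lemma quotient_coneE : quotient_cone Vp W = quotient_section @^-1` Vp.
Proof.
have imE : quotient_map W @` Vp = quotient_section @^-1` Vp.
  rewrite predeqE => q; split => [[v Cv <-]|Cq].
    by rewrite /preimage /= quotient_section_map; have [] := L_projection_positive Cv.
  by exists (quotient_section q) => //; exact: quotient_sectionK.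
rewrite /quotient_cone imE; apply/esym/closure_id.
apply: closed_comp; last exact: osn_closed.
move=> x _; apply: (@linear_contraction_continuous _ _ _ quotient_section).
by move=> q; rewrite norm_quotient_section.
Qed.

Lemma L_summand_quotient : order_smooth_1_normed (quotient_cone Vp W).
Proof.
rewrite quotient_coneE; apply: order_smooth_preimage => //.
  exact: norm_quotient_section.
(* A decomposition of the lifted element in [V] is mapped back down by the quotient map. *)
rewrite -quotient_coneE => q.
have [v1 [v2 [C1 C2 vE vle]]] := hOS (quotient_section q).
exists (quotient_map W v1), (quotient_map W v2); split.
- by apply: subset_closure; exists v1.
- by apply: subset_closure; exists v2.
- by rewrite -quotient_mapB -vE; exact/esym/quotient_sectionK.
- move: vle; rewrite [leRHS]norm_quotient_section; apply: le_trans.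
  by apply: lerD; exact: quotient_norm_le.
Qed.

Lemma compose_projection_subproof (f : dual V) : (f \o P : V -> R^o) \in dual_pred V.
Proof.
have /asboolP[fl fc] := valP f; apply/asboolP; split=> [a x y|x].
  by rewrite /= linearP; exact: fl.
apply: continuous_comp; last exact: fc.
by apply: linear_contraction_continuous; exact: L_projection_le.
Qed.

Definition compose_projection (f : dual V) : dual V :=
  exist (fun g => g \in dual_pred _) _ (compose_projection_subproof f).

Lemma positive_dual_imageE : positive_dual_image Vp W =
  [set q | forall w, subspace_cone Vp W w -> 0 <= dual_quotient_ident q w].
Proof.
rewrite predeqE => q; split => [[f fp <-] w Cw|qp].
  by rewrite dual_quotient_identE; exact: fp.
(* Composing with [P] leaves the restriction to [W] unchanged, and [P] sends [Vp] into the cone of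
   [W], where [q] is nonnegative. *)
exists (compose_projection (repr q)).
  move=> v /L_projection_positive[Cv _].
  exact: (qp (exist _ (P v) (PW v))).
apply: dual_quotient_ident_inj; rewrite dual_quotient_identE.
apply/val_inj/funext => w /=.
by rewrite /dual_fun/= PK//; exact: valP.
Qed.

Lemma positive_dual_image_closed : closed (positive_dual_image Vp W).
Proof.
rewrite positive_dual_imageE.
(* An intersection of half-spaces, each closed because evaluation at [w] is continuous: it factors
   through the two initial topologies, then a coordinate projection. *)
rewrite (_ : [set q | _] = \bigcap_(w in subspace_cone Vp W)
    ((fun q : weak_star_quotient W => dual_quotient_ident q w : R^o) @^-1`
      [set x | 0 <= x])); last by rewrite predeqE.
apply: closed_bigI => w _; apply: closed_comp; last exact: closed_ge.
move=> q _; apply: (@continuous_comp (weak_star_quotient W)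
  (weak_star (subspace_of W)) _ (dual_quotient_ident (W := W))
  (fun g : weak_star _ => dual_fun g w)).
  exact: initial_continuous.
apply: (@continuous_comp (weak_star (subspace_of W)) {ptws subspace_of W -> R^o} _
  (@dual_fun R (subspace_of W)) (fun h => h w)).
  exact: initial_continuous.
exact: (@proj_continuous _ (fun=> R^o) w).
Qed.


End Positive.

Theorem theorem4p1 (R : realType) (V : completeNormedModType R) (Vp : set V)
  (W : closedSubspace V) (hV : order_smooth_1_normed Vp) (hOS : OS_1_2 Vp)
  (hW : L_summand W) : smooth_1_order_ideal Vp W.
Proof.
have [P [PW PK normP]] := L_projection hW; split.
- apply/closure_id; exact: (positive_dual_image_closed hV hOS normP PW PK).
- exact: (L_summand_subspace hV hOS normP PW PK).
- exact: (L_summand_quotient hV hOS normP PW PK).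
Qed.
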